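(* Let $\epsilon>0$ and let $\mathbf d=(\mathbf a,\mathbf b)\in\mathbb Z^{N\times2}$ range over a sequence of bidegree sequences with $\sum_n a_n=\sum_n b_n=S$ and $\max_i\max(a_i,b_i)=O(S^{\frac14-\epsilon})$. Then $$\|G_{\mathbf d}\|=\big[1+O(S^{-4\epsilon})\big]\frac{S!}{\prod_{i=1}^N a_i!\,b_i!}\exp\Big(\frac{-(\alpha_2-\alpha_1)(\beta_2-\beta_1)}{2S^2}\Big).$$
   Context: $\|G_{\mathbf d}\|$ is the number of directed graphs on $\{1,\dots,N\}$ (each ordered pair, including loops, carrying at most one edge) with in-degree sequence $\mathbf a$ and out-degree sequence $\mathbf b$; equivalently the number of $N\times N$ $0$-$1$ matrices with row sums $\mathbf a$ and column sums $\mathbf b$. $\alpha_k=\sum_n a_n^k$, $\beta_k=\sum_n b_n^k$ (so $\alpha_1=\beta_1=S$). $O(\cdot)$ is with respect to $S\to\infty$ along the sequence. *)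

(* Defs.v *)
From mathcomp Require Import all_boot all_order all_algebra.
From mathcomp Require Import all_classical all_reals all_analysis.
Set Implicit Arguments.
Unset Strict Implicit.
Unset Printing Implicit Defensive.
Import Order.TTheory GRing.Theory Num.Theory.
Import numFieldNormedType.Exports.

(* A directed graph on 'I_N is given by its set of edges: (i, j) \in E is the
   edge from i to j.  Loops are allowed, multiple edges are not. *)
Definition digraph (N : nat) := {set 'I_N * 'I_N}.

Definition in_degree N (E : digraph N) (i : 'I_N) : nat :=
  #|[set j : 'I_N | (j, i) \in E]|.

Definition out_degree N (E : digraph N) (i : 'I_N) : nat :=
  #|[set j : 'I_N | (i, j) \in E]|.

Definition digraphs_with_bidegree N (a b : 'I_N -> nat) : {set digraph N} :=
  [set E : digraph N |
    [forall i, (in_degree E i == a i) && (out_degree E i == b i)]].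

Definition power_sum N (k : nat) (a : 'I_N -> nat) : nat :=
  \sum_(i < N) a i ^ k.

Definition max_degree N (a b : 'I_N -> nat) : nat :=
  \max_(i < N) maxn (a i) (b i).

(* Main.v *)
(* Configuration model: give vertex i b_i out-points and a_i in-points, and let a
   permutation s of the S points join out-point t to in-point s t.  Every digraph
   with the given degrees comes from exactly prod a_i! b_i! permutations, so one
   must estimate the probability that s creates no multiple edge.  A multiple edge
   is a "clash": two out-points p1 < p2 of one vertex sent to q1 and q2, two
   in-points of one vertex.  There are (alpha_2 - alpha_1)(beta_2 - beta_1)/2
   clashes.  Forbid them one after the other: exchanging the images of p and of a
   random point shows that, given any set of already forbidden clashes, a further
   clash has conditional probability S^-2 (1 + O(d^2 / S)), where d is the maximal
   degree.  The product of the factors 1 - S^-2 (1 + O(d^2 / S)) is the exponential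
   of the theorem up to a factor 1 + O(d^4 / S). *)
Require Import Defs.
From mathcomp Require Import all_boot all_fingroup.
From mathcomp Require Import zify.
Set Implicit Arguments.
Unset Strict Implicit.
Unset Printing Implicit Defensive.

(** * Switchings *)

Section Switching.
Variables (T I J : finType) (f : T -> I) (g : T -> J) (d : nat).
Hypothesis f_le : forall i, #|[set t | f t == i]| <= d.
Hypothesis g_le : forall j, #|[set t | g t == j]| <= d.
Implicit Types (s : {perm T}) (F : seq ((T * T) * (T * T))) (D : seq (T * T)).

(** A pair [(p, q)] stands for the edge from out-point [p] to in-point [q]; [f] and [g] give the
    vertices of out-points and of in-points. *)
Definition occurs s (e : (T * T) * (T * T)) :=
  (s e.1.1 == e.1.2) && (s e.2.1 == e.2.2).

(** Conditioning is encoded by the edges [D] required so far and the clashes [F] already forbidden;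
    probabilities become ratios of such cardinals. *)
Definition avoiding F D : {set {perm T}} :=
  [set s : {perm T} | all (fun x => s x.1 == x.2) D &&
                      all (fun e => ~~ occurs s e) F].

Definition clash (e : (T * T) * (T * T)) :=
  [&& e.1.1 != e.2.1, f e.1.1 == f e.2.1, e.1.2 != e.2.2 & g e.1.2 == g e.2.2].

Lemma card_bigcup_le (K : finType) (U : finType) (A : {set U}) (k : U -> {set K}) c :
  (forall u, u \in A -> #|k u| <= c) -> #|\bigcup_(u in A) k u| <= #|A| * c.
Proof.
move=> kc; rewrite -sum_nat_const.
elim/big_rec2: _ => [|u n B uA IH]; first by rewrite cards0.
by rewrite (leq_trans (leq_card_setU _ _)) // leq_add // kc.
Qed.

Definition row p : {set T} := [set t | f t == f p].
Definition shared_col s (A : {set T}) : {set T} :=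
  \bigcup_(t in A) [set x | g (s x) == g (s t)].

Lemma card_col s j : #|[set x | g (s x) == j]| <= d.
Proof.
rewrite (leq_trans _ (g_le j)) // -(card_imset _ (@perm_inj _ s)).
apply: subset_leq_card; apply/subsetP => y /imsetP[x]; rewrite !inE => xj ->.
by [].
Qed.

Lemma card_shared_col s (A : {set T}) : #|A| <= d -> #|shared_col s A| <= d ^ 2.
Proof.
move=> Ad; rewrite (leq_trans (card_bigcup_le (c := d) _)) //.
  by move=> u _; exact: card_col.
by rewrite -mulnn leq_mul2r Ad orbT.
Qed.

(* Contains every x for which exchanging the images of p and x may create a clash
   or move a point whose image is prescribed by D. *)
Definition bad_swaps D s p : {set T} :=
  [set x in unzip1 D] :|: shared_col s (row p) :|:
  \bigcup_(t in [set t | g (s t) == g (s p)]) row t.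

Lemma card_bad_swaps D s p : #|bad_swaps D s p| <= 2 * d ^ 2 + size D.
Proof.
rewrite /bad_swaps (leq_trans (leq_card_setU _ _)) //.
have h1 : #|[set x in unzip1 D]| <= size D.
  by rewrite cardsE (leq_trans (card_size _)) // size_map.
have h2 := card_shared_col s (f_le (f p)).
have h3 : #|\bigcup_(t in [set t | g (s t) == g (s p)]) row t| <= d ^ 2.
  rewrite (leq_trans (card_bigcup_le (c := d) _)) //.
    by move=> u _; exact: f_le.
  by rewrite -mulnn leq_mul2r card_col orbT.
have [+ _] := leq_card_setU [set x in unzip1 D] (shared_col s (row p)).
rewrite /row in h1 h2 h3 *; lia.
Qed.

(** In [tperm p x * s] the points [p] and [x] exchange images. Only their two edges change, and as
    [x] is not bad neither new edge is parallel to another one; so a clash of [F] present afterwards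
    was present before. *)
Lemma swap_avoiding F D s p x : all clash F -> p \notin unzip1 D ->
  s \in avoiding F D -> x \notin bad_swaps D s p ->
  (tperm p x * s)%g \in avoiding F D.
Proof.
move=> /allP Fc pD; rewrite !inE => /andP[/allP sD /allP sF].
rewrite !negb_or => /andP[/andP[xD xc] xr].
have xpr t : f t = f p -> g (s x) != g (s t).
  move=> ft; apply: contraNN xc => gx; apply/bigcupP; exists t => //.
    by rewrite inE ft.
  by rewrite inE.
have xpc t : g (s t) = g (s p) -> f x != f t.
  move=> gt; apply: contraNN xr => fx; apply/bigcupP; exists t => //.
    by rewrite inE gt.
  by rewrite inE.
have key t t' : t != t' -> f t = f t' ->
    g ((tperm p x * s)%g t) = g ((tperm p x * s)%g t') -> t != p /\ t != x.
  rewrite !permM => tt' ft gt; split; apply/eqP=> te; subst t.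
    move: gt; rewrite tpermL; case: tpermP => [t'e|t'e|_ _] gt.
    - by rewrite t'e eqxx in tt'.
    - by have := xpr _ (erefl (f p)); rewrite gt eqxx.
    - by have := xpr t' (esym ft); rewrite gt eqxx.
  move: gt; rewrite tpermR; case: tpermP => [t'e|t'e|_ _] gt.
  - by have := xpc p (erefl _); rewrite ft t'e eqxx.
  - by rewrite t'e eqxx in tt'.
  - by have := xpc t' (esym gt); rewrite ft eqxx.
apply/andP; split; apply/allP.
  move=> y yD; rewrite permM tpermD ?sD //.
    by apply: contraNneq pD => ->; apply: map_f.
  by apply: contraNneq xD => ->; exact: map_f.
move=> e eF; apply/negP => /andP[/eqP e1 /eqP e2].
have /and4P[e12 /eqP fe _ /eqP ge] := Fc _ eF.
have [e1p e1x] := key _ _ e12 fe (etrans (congr1 g e1) (etrans ge (esym (congr1 g e2)))).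
have [e2p e2x] : e.2.1 != p /\ e.2.1 != x.
  by apply: (key _ e.1.1); rewrite 1?eq_sym // e1 e2.
have := sF _ eF; rewrite /occurs -e1 -e2 !permM.
by rewrite !tpermD 1?eq_sym // !eqxx.
Qed.

(* Double counting along (s, x) |-> (tperm p x * s, x): X s bounds additional bad
   choices of x, and Y s' lists the x that may have led to s'. *)
Lemma switching F D p (A : {set {perm T}}) (L M : nat)
    (X : {perm T} -> {set T}) (Y : {perm T} -> {set T}) :
  all clash F -> p \notin unzip1 D -> A \subset avoiding F D ->
  (forall s, s \in A -> #|X s| <= L) -> (forall s, #|Y s| <= M) ->
  (forall s x, s \in A -> x \notin X s -> x \in Y (tperm p x * s)%g) ->
  #|A| * (#|T| - (2 * d ^ 2 + size D + L)) <= M * #|avoiding F D|.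
Proof.
move=> Fc pD /subsetP AF XL YM AY.
pose B s := bad_swaps D s p :|: X s.
pose P := [set z : {perm T} * T | (z.1 \in A) && (z.2 \notin B z.1)].
pose Q := [set z : {perm T} * T | (z.1 \in avoiding F D) && (z.2 \in Y z.1)].
have cardP : #|A| * (#|T| - (2 * d ^ 2 + size D + L)) <= #|P|.
  rewrite -sum_nat_const -sum1dep_card.
  rewrite -(pair_big_dep (fun s => s \in A) (fun s x => x \notin B s)
              (fun _ _ => 1)) /=.
  apply: leq_sum => s sA; rewrite sum1dep_card.
  have -> : #|[set x | x \notin B s]| = #|~: B s|.
    by apply: eq_card => x; rewrite !inE.
  rewrite cardsCs setCK leq_sub2l //.
  rewrite (leq_trans (leq_card_setU _ _)) // leq_add ?XL //.
  exact: card_bad_swaps.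
have cardQ : #|Q| <= M * #|avoiding F D|.
  rewrite mulnC -sum_nat_const -sum1dep_card.
  rewrite -(pair_big_dep (fun s => s \in avoiding F D) (fun s x => x \in Y s)
              (fun _ _ => 1)) /=.
  by apply: leq_sum => s _; rewrite sum1_card.
apply: (leq_trans cardP); apply: leq_trans cardQ.
pose h (z : {perm T} * T) := ((tperm p z.2 * z.1)%g, z.2).
have hinj : injective h by move=> [s x] [s' x'] [] /[swap] -> /mulgI ->.
rewrite -(card_imset _ hinj); apply: subset_leq_card.
apply/subsetP => _ /imsetP[[s x] + ->].
rewrite inE /= in_setU negb_or => /and3P[sA xb xX].
by rewrite inE /= swap_avoiding ?AF //= AY.
Qed.

(** Switch away from [p -> q]: afterwards [x] is the preimage of [q], so it can be recovered and
    each result has at most one origin. *)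
Lemma card_fix_le F D p q : all clash F -> p \notin unzip1 D ->
  #|avoiding F ((p, q) :: D)| * (#|T| - (2 * d ^ 2 + size D)) <= #|avoiding F D|.
Proof.
move=> Fc pD; have AF : avoiding F ((p, q) :: D) \subset avoiding F D.
  by apply/subsetP => s; rewrite !inE /= -andbA => /and3P[_ -> ->].
have := @switching F D p _ 0 1 (fun=> set0) (fun s => [set s^-1%g q]) Fc pD AF.
rewrite addn0 mul1n; apply=> [s _|s|s x sA _]; rewrite ?cards0 ?cards1 //.
rewrite inE invMg tpermV permM; move: sA; rewrite !inE /= => /andP[/andP[/eqP <- _] _].
by rewrite permK tpermL.
Qed.

(** After the switch [x] carries the old image of [p], so it is one of at most [d] points mapped
    above [j]. *)
Lemma card_cell_le F D p j : all clash F -> p \notin unzip1 D ->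
  #|[set s in avoiding F D | g (s p) == j]| * (#|T| - (2 * d ^ 2 + size D))
    <= d * #|avoiding F D|.
Proof.
move=> Fc pD; have AF : [set s in avoiding F D | g (s p) == j] \subset avoiding F D.
  by apply/subsetP => s; rewrite inE => /andP[].
have := @switching F D p _ 0 d (fun=> set0) (fun s => [set x | g (s x) == j]) Fc pD AF.
rewrite addn0; apply=> [s _|s|s x sA _]; rewrite ?cards0 ?card_col //.
by case/setIdP: sA => _ /eqP <-; rewrite inE permM tpermR.
Qed.

(* Redirecting p to q creates the edges p -> q and s^-1 q -> s p.  If no
   clash of F pairs (p, q) with an element of D, a clash of F can only arise when
   one of them doubles an existing edge: the first one when s is in crowded_start
   (with j = g q), the second one when s is in crowded_end. *)
Definition crowded_start F D p j : {set {perm T}} :=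
  \bigcup_(t in row p :\: [set x in p :: unzip1 D])
    [set s in avoiding F D | g (s t) == j].

Definition crowded_end F D p q : {set {perm T}} :=
  [set s in avoiding F D | (s p != q) &&
    [exists t in row (s^-1%g q) :\ p, g (s p) == g (s t)]].

Lemma card_crowded_start F D p j : all clash F ->
  #|crowded_start F D p j| * (#|T| - (2 * d ^ 2 + size D))
    <= d ^ 2 * #|avoiding F D|.
Proof.
move=> Fc; set c := _ - _.
have [B|] := leqP #|row p| d; last by rewrite ltnNge f_le.
have sub : #|row p :\: [set x in p :: unzip1 D]| <= d.
  by apply: leq_trans B; apply: subset_leq_card; apply: subsetDl.
rewrite (@leq_trans (\sum_(t in row p :\: [set x in p :: unzip1 D]) 
   #|[set s in avoiding F D | g (s t) == j]| * c)) //.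
  rewrite -big_distrl leq_mul2r; apply/orP; right.
  rewrite /crowded_start; elim/big_rec2: _ => [|u n C _ IH]; first by rewrite cards0.
  by rewrite (leq_trans (leq_card_setU _ _)) // leq_add.
rewrite (@leq_trans (\sum_(t in row p :\: [set x in p :: unzip1 D])
   d * #|avoiding F D|)) //.
  apply: leq_sum => t; rewrite !inE negb_or => /andP[/andP[_ tD] _].
  exact: card_cell_le.
by rewrite sum_nat_const -mulnn -mulnA leq_mul2r sub orbT.
Qed.

(** Once [x] takes over the image of [p], it shares an in-vertex with some [t] in the row of the
    preimage of [q]: [d ^ 2] choices. Keeping [x] out of that row leaves this preimage in place and
    costs [d] more bad choices, whence [3 * d ^ 2]. *)
Lemma card_crowded_end F D p q : all clash F -> p \notin unzip1 D ->
  #|crowded_end F D p q| * (#|T| - (3 * d ^ 2 + size D))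
    <= d ^ 2 * #|avoiding F D|.
Proof.
move=> Fc pD.
have AF : crowded_end F D p q \subset avoiding F D.
  by apply/subsetP => s; rewrite inE => /andP[].
have d2 : d <= d ^ 2 by rewrite -mulnn; case: (d) => // n; rewrite leq_pmulr.
have := @switching F D p _ d (d ^ 2) (fun s => row (s^-1%g q))
  (fun s => shared_col s (row (s^-1%g q))) Fc pD AF.
move=> H; apply: leq_trans (H _ _ _) => [|s _|s|s x].
- by rewrite leq_mul2l leq_sub2l ?orbT //; lia.
- exact: f_le.
- by rewrite card_shared_col // f_le.
case/setIdP => _ /andP[spq /existsP[t /andP[]]].
rewrite !inE => /andP[tp tr] /eqP gt xr.
have pq : p != s^-1%g q by apply: contraNneq spq => ->; rewrite permKV.
have xq : x != s^-1%g q by apply: contraNneq xr => ->.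
have xt : x != t by apply: contraNneq xr => ->.
rewrite invMg tpermV permM tpermD //.
apply/bigcupP; exists t; first by rewrite inE.
by rewrite inE !permM tpermR gt tpermD // eq_sym.
Qed.

Lemma avoiding_cons F D p q :
  avoiding F ((p, q) :: D) = [set s in avoiding F D | s p == q].
Proof. by apply/setP => s; rewrite !inE /= -andbA andbC. Qed.

(** Outside the two crowded sets the new edge at the old preimage of [q] has no parallel edge, and
    [p -> q] has at most parallels prescribed by [D], which [F] does not forbid together with
    [(p, q)]. *)
Lemma swap_in_avoiding F D p q s :
  all clash F -> p \notin unzip1 D -> q \notin unzip2 D ->
  (forall y, y \in D -> ((p, q), y) \notin F /\ (y, (p, q)) \notin F) ->
  s \in avoiding F D -> s \notin crowded_start F D p (g q) ->
  s \notin crowded_end F D p q ->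
  (tperm p (s^-1%g q) * s)%g \in avoiding F ((p, q) :: D).
Proof.
move=> Fc pD qD DF sO cs ce.
rewrite avoiding_cons inE permM tpermL permKV eqxx andbT.
have [spq|spq] := eqVneq (s p) q.
  by rewrite -spq permK tperm1 mul1g.
set r := s^-1%g q.
have pr : p != r by apply: contraNneq spq => ->; rewrite permKV.
have sr : s r = q by rewrite permKV.
move: (sO); rewrite !inE => /andP[/allP sD /allP sF].
have rD : r \notin unzip1 D.
  apply: contraNN qD => /mapP[y yD re]; apply/mapP; exists y => //.
  by rewrite -sr re; apply/eqP/sD.
have cs' t : t != p -> f t = f p -> g (s t) = g q -> t \in unzip1 D.
  move=> tp ft gt; apply: contraNT cs => tD; apply/bigcupP; exists t.
    by rewrite !inE negb_or tp tD ft eqxx.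
  by rewrite inE sO gt eqxx.
have ce' t : t != p -> f t = f r -> g (s t) != g (s p).
  move=> tp ft; apply: contraNN ce => /eqP gt; rewrite inE sO spq /=.
  by apply/existsP; exists t; rewrite !inE tp ft gt !eqxx.
set s' := (tperm p r * s)%g.
have s'p : s' p = q by rewrite permM tpermL.
have s'r : s' r = s p by rewrite permM tpermR.
have s'D t : t != p -> t != r -> s' t = s t.
  by move=> tp tr; rewrite permM tpermD // eq_sym.
have key t t' : t != t' -> f t = f t' -> g (s' t) = g (s' t') ->
   t != r /\ (t = p -> (t', s' t') \in D).
  move=> tt' ft gt.
  have tr : t != r.
    apply/eqP => te; move: gt; rewrite te s'r.
    have [t'p|t'p] := eqVneq t' p.
      have frp : f r = f p by rewrite -te ft t'p.
      by move=> _; have := cs' r; rewrite eq_sym pr sr (negPf rD) => /(_ isT frp erefl).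
    have t'r : t' != r by rewrite eq_sym -te.
    by move/esym/eqP; rewrite s'D //; apply/negP/ce' => //; rewrite -te.
  split=> // tp; rewrite tp in tt' ft gt *.
  have t'p : t' != p by rewrite eq_sym.
  have t'r : t' != r.
    apply: contraNneq rD => t'r; apply: cs'.
    - by rewrite eq_sym.
    - by rewrite -t'r.
    - by rewrite sr.
  rewrite s'D //; rewrite s'p s'D // in gt.
  have /mapP[y yD ye] := cs' _ t'p (esym ft) (esym gt).
  by rewrite ye (eqP (sD _ yD)) -surjective_pairing.
apply/andP; split; apply/allP.
  move=> y yD; rewrite /= -/s' s'D ?sD //.
    by apply: contraNneq pD => <-; apply: map_f.
  by apply: contraNneq rD => <-; apply: map_f.
move=> e eF; apply/negP => /andP[/eqP e1 /eqP e2].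
have /and4P[e12 /eqP fe _ /eqP ge] := allP Fc _ eF.
have [e1r e1p] := key _ _ e12 fe (etrans (congr1 g e1) (etrans ge (esym (congr1 g e2)))).
have e21 : e.2.1 != e.1.1 by rewrite eq_sym.
have [e2r e2p] := key _ _ e21 (esym fe)
  (etrans (congr1 g e2) (etrans (esym ge) (esym (congr1 g e1)))).
have [e1p'|e1p'] := eqVneq e.1.1 p.
  have /DF[+ _] := e1p e1p'; rewrite e2 -surjective_pairing.
  rewrite -[q]s'p -{1}e1p' -[s' p](congr1 s' e1p') e1.
  by rewrite -!surjective_pairing eF.
have [e2p'|e2p'] := eqVneq e.2.1 p.
  have /DF[_] := e2p e2p'; rewrite e1 -surjective_pairing.
  rewrite -[q]s'p -{1}e2p' -[s' p](congr1 s' e2p') e2.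
  by rewrite -!surjective_pairing eF.
have := sF _ eF; rewrite /occurs -(s'D _ e1p' e1r) -(s'D _ e2p' e2r).
by rewrite e1 e2 !eqxx.
Qed.

(** Redirecting [p] to [q] is injective once the old preimage of [q] is recorded, and that has at
    most [#|T|] values. *)
Lemma card_fix_ge F D p q : all clash F -> p \notin unzip1 D -> q \notin unzip2 D ->
  (forall y, y \in D -> ((p, q), y) \notin F /\ (y, (p, q)) \notin F) ->
  #|avoiding F D| <= #|T| * #|avoiding F ((p, q) :: D)|
    + #|crowded_start F D p (g q)| + #|crowded_end F D p q|.
Proof.
move=> Fc pD qD DF; rewrite -addnA.
set C := crowded_start F D p (g q) :|: crowded_end F D p q.
have CB : #|C| <= #|crowded_start F D p (g q)| + #|crowded_end F D p q|.
  exact: leq_card_setU.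
rewrite (leq_trans _ (leq_add (leqnn _) CB)) //.
rewrite -(cardsID C (avoiding F D)) addnC leq_add //; last first.
  by apply: subset_leq_card; apply: subsetIr.
rewrite mulnC -cardsT -cardsX.
pose h s := ((tperm p (s^-1%g q) * s)%g, s^-1%g q).
have hinj : injective h by move=> s s' [] /[swap] -> /mulgI ->.
rewrite -(card_imset _ hinj); apply: subset_leq_card; apply/subsetP => _ /imsetP[s + ->].
rewrite in_setD in_setU negb_or => /andP[/andP[cs ce] sO].
by rewrite in_setX in_setT andbT swap_in_avoiding.
Qed.

Lemma card_avoiding_nil : #|avoiding [::] [::]| = (#|T|)`!.
Proof.
rewrite -cardsT -card_perm; apply: eq_card => s.
by rewrite !inE; apply/esym/subsetP => t _; rewrite inE.
Qed.

(** The new clash occurs exactly when its two edges are prescribed; [e.1] stands at the tail because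
    it is to be prescribed first. *)
Lemma card_avoiding_cons F (e : (T * T) * (T * T)) :
  #|avoiding F [::]| = #|avoiding (e :: F) [::]| + #|avoiding F [:: e.2; e.1]|.
Proof.
rewrite -(cardsID [set s : {perm T} | occurs s e] (avoiding F [::])) addnC.
congr (_ + _); apply: eq_card => s; rewrite !inE /= ?andbT //.
by rewrite /occurs andbC [X in X && _]andbC.
Qed.

End Switching.

(** * Counting configurations *)

Section Fiber.
Variables (U I : finType) (h : U -> I).

Definition liftings (A : {pred U}) n (w : n.-tuple I) :=
  [set u : n.-tuple U | [&& all A u, uniq u & map h u == w]].

(** Each fibre is exactly as large as the multiplicity of its letter, so a lifting orders every
    fibre completely. Induction on the word: choose [x] above the first letter and delete it from
    [A]. *)
Lemma card_liftings n (w : n.-tuple I) (A : {pred U}) :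
  (forall i, #|[pred x in A | h x == i]| = count_mem i w) ->
  #|liftings A w| = \prod_i (count_mem i w)`!.
Proof.
elim: n w A => [|n IHn] w A cA.
  rewrite tuple0 /= big1 ?(@eq_card1 _ [tuple]) // => t.
  by rewrite [t]tuple0 !inE.
case/tupleP: w cA => i w cA.
pose B := [pred x in A | h x == i].
rewrite /liftings -sum1dep_card (partition_big (@thead _ _) B) /= => [|t]; last first.
  case/tupleP: t => x t /and3P[/andP[Ax _] _ /eqP[hx _]].
  by rewrite theadE /B /= hx eqxx andbT; exact: Ax.
have cB : #|B| = (count_mem i w).+1 by rewrite /B cA /= eqxx.
transitivity (#|B| * \prod_i (count_mem i w)`!); last first.
  rewrite (bigD1 i) //= [in RHS](bigD1 i) //= eqxx cB add1n factS -mulnA.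
  congr (_ * (_ * _)).
  by apply: eq_bigr => j; rewrite eq_sym => /negPf ->.
rewrite -sum_nat_const; apply: eq_bigr => x /andP[Ax /eqP hx].
rewrite -(IHn w [predD1 A & x]); last first.
  move=> j; have := cA j; rewrite (cardD1 x) !inE hx /= Ax /=.
  move/eqP; rewrite eqn_add2l => /eqP <-.
  by apply: eq_card => y; rewrite !inE andbA.
rewrite -sum1_card (reindex (fun t : n.-tuple U => [tuple of x :: t])) /=; last first.
  pose ttail (t : n.+1.-tuple U) := [tuple of behead t].
  exists ttail => [t _ | t /andP[_ /eqP <-]]; first exact: val_inj.
  by rewrite -tuple_eta.
apply: eq_bigl => t; rewrite /liftings inE theadE eqxx andbT.
rewrite [A x]Ax eqseq_cons hx eqxx /=.
have aux (s : seq U) : all [predD1 A & x] s = (x \notin s) && all A s.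
  elim: s => //= y s ->; rewrite inE negb_or [y == x]eq_sym.
  by rewrite -!andbA; congr (_ && _); rewrite andbCA.
by rewrite aux !andbA [all A _ && _]andbC.
Qed.
End Fiber.

Section Configurations.
Variables (n : nat) (I J : finType) (f : 'I_n -> I) (g : 'I_n -> J).
Implicit Types (s : 'S_n) (E : {set I * J}).

Local Notation edge s := (fun t => (f t, g (s t))).

Definition realizes s E := injectiveb (edge s) && ([set edge s t | t in 'I_n] == E).

Lemma card_preim_tuple (K : finType) (k : 'I_n -> K) i :
  count_mem i [tuple k t | t < n] = #|[set t | k t == i]|.
Proof.
rewrite /= count_map cardE size_filter -enumT.
by apply: eq_count => t; rewrite !inE.
Qed.

Lemma card_tuple_liftings (U K : finType) (h : U -> K) (A : {set U}) (k : 'I_n -> K) :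
  (forall i, #|[set x in A | h x == i]| = #|[set t | k t == i]|) ->
  #|liftings h (mem A) [tuple k t | t < n]| = \prod_i (#|[set t | k t == i]|)`!.
Proof.
move=> cA; rewrite card_liftings => [|i].
  by apply: eq_bigr => i _; rewrite card_preim_tuple.
by rewrite card_preim_tuple -cA; apply: eq_card => x; rewrite !inE.
Qed.

Lemma mem_liftings (U K : finType) (h : U -> K) (A : {set U}) (k : 'I_n -> K)
    (u : n.-tuple U) :
  reflect [/\ forall t, tnth u t \in A, injective (tnth u) & forall t, h (tnth u t) = k t]
    (u \in liftings h (mem A) [tuple k t | t < n]).
Proof.
rewrite inE; apply: (iffP and3P) => [[/all_tnthP uA uu /eqP hu]|[uA ui hu]]; split.
- by move=> t; exact: uA.
- by apply/tuple_uniqP.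
- move=> t; have -> : k t = tnth [tuple k t | t < n] t by rewrite tnth_mktuple.
  by rewrite -(tnth_map h); congr (tnth _ t); apply: val_inj.
- by apply/all_tnthP => t; exact: uA.
- by apply/tuple_uniqP.
- apply/eqP; rewrite -[LHS]/(val (map_tuple h u)); congr val.
  by apply: eq_from_tnth => t; rewrite tnth_map tnth_mktuple.
Qed.

Section Fixed.
Variable E : {set I * J}.
Hypothesis E_row : forall i, #|[set j | (i, j) \in E]| = #|[set t | f t == i]|.
Hypothesis E_col : forall j, #|[set i | (i, j) \in E]| = #|[set t | g t == j]|.

Let E_fst i : #|[set x in E | x.1 == i]| = #|[set t | f t == i]|.
Proof.
rewrite -E_row -(card_in_imset (f := snd)) => [|[a b] [c d]]; last first.
  by rewrite !inE /= => /andP[_ /eqP ->] /andP[_ /eqP ->] ->.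
apply: eq_card => j; rewrite [RHS]inE; apply/imsetP/idP => [[[a b]]|Ej].
  by rewrite inE /= => /andP[Eab /eqP <-] ->.
by exists (i, j) => //; rewrite inE /= Ej eqxx.
Qed.

Let E_snd j : #|[set x in E | x.2 == j]| = #|[set t | g t == j]|.
Proof.
rewrite -E_col -(card_in_imset (f := fst)) => [|[a b] [c d]]; last first.
  by rewrite !inE /= => /andP[_ /eqP ->] /andP[_ /eqP ->] ->.
apply: eq_card => i; rewrite [RHS]inE; apply/imsetP/idP => [[[a b]]|Ei].
  by rewrite inE /= => /andP[Eab /eqP <-] ->.
by exists (i, j) => //; rewrite inE /= Ei eqxx.
Qed.

Let card_E : #|E| = n.
Proof.
rewrite -[RHS]card_ord -sum1_card (partition_big fst predT) //=.
rewrite -[RHS]sum1_card [RHS](partition_big f predT) //=; apply: eq_bigr => i _.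
by rewrite sum1dep_card E_fst -sum1dep_card.
Qed.

Let onto_E (u : 'I_n -> I * J) :
  (forall t, u t \in E) -> injective u -> [set u t | t in 'I_n] = E.
Proof.
move=> uE ui; apply/eqP; rewrite eqEcard card_E card_imset // card_ord leqnn andbT.
by apply/subsetP => _ /imsetP[t _ ->].
Qed.

(* A permutation with edge set E amounts to a pair of bijections from the points to
   E, one above f and one above g. *)
Lemma card_realizes : #|[set s | realizes s E]| =
  \prod_i (#|[set t | f t == i]|)`! * \prod_j (#|[set t | g t == j]|)`!.
Proof.
rewrite -(card_tuple_liftings E_fst) -(card_tuple_liftings E_snd) -cardsX.
(* The first tuple lists the edges by out-point, the second by in-point; [s] is the matching between
   the two lists. *)
pose phi s := ([tuple edge s t | t < n], [tuple (f (s^-1%g t), g t) | t < n]).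
rewrite -(@card_in_imset _ _ phi) => [|s s']; last first.
  rewrite !inE => _ /andP[/injectiveP si' _] e.
  have e1 := congr1 fst e; have e2 := congr1 snd e.
  apply/permP => t; apply: (perm_inj (s := s'^-1%g)); rewrite permK; apply/esym.
  apply: si'; rewrite permKV.
  have := congr1 (fun u => tnth u (s t)) e2.
  have := congr1 (fun u => tnth u t) e1.
  by rewrite !tnth_mktuple permK => -[->] -[->].
apply: eq_card => -[u v]; rewrite in_setX; apply/imsetP/andP.
  move=> [s]; rewrite inE => /andP[/injectiveP si /eqP sE] [-> ->].
  have edgeE t : edge s t \in E by rewrite -sE; apply/imsetP; exists t.
  split; apply/mem_liftings; split => t; rewrite ?tnth_mktuple //.
  - by move=> t'; rewrite !tnth_mktuple; apply: si.
  - by have := edgeE (s^-1%g t); rewrite permKV.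
  - move=> t'; rewrite !tnth_mktuple => e.
    have : edge s (s^-1%g t) = edge s (s^-1%g t') by rewrite /= !permKV.
    by move/si/perm_inj.
case=> /mem_liftings[uE ui hu] /mem_liftings[vE vi hv].
(* Both tuples enumerate [E], so each entry of [u] occurs in [v]; its position there defines the
   permutation. *)
have vu t : exists t', tnth v t' == tnth u t.
  have := uE t; rewrite -{1}(onto_E vE vi) => /imsetP[t' _ ->].
  by exists t'.
have [s0 s0P] := fin_all_exists vu.
have s0i : injective s0.
  by move=> t t' e; apply: ui; rewrite -(eqP (s0P t)) -(eqP (s0P t')) e.
pose s := perm s0i.
have us t : tnth u t = edge s t.
  by rewrite /= permE -hv (eqP (s0P t)) -hu -surjective_pairing.
exists s.
  rewrite inE; apply/andP; split.
    by apply/injectiveP => t t'; rewrite /= -!us; apply: ui.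
  by rewrite -(onto_E uE ui); apply/eqP/eq_imset => t; rewrite us.
congr (_, _); apply: eq_from_tnth => t; rewrite tnth_mktuple ?us //.
have := s0P (s^-1%g t); rewrite -[s0 _](permE s0i) permKV => /eqP ->.
by rewrite us /= permKV.
Qed.
End Fixed.

(** Simple configurations are sorted by edge set, each class being counted by [card_realizes].
    Without repeated edges a vertex has as many neighbours as points, so these edge sets have the
    prescribed degrees. *)
Lemma card_simple (A : {set {set I * J}}) :
  (forall E, (E \in A) = [forall i, #|[set j | (i, j) \in E]| == #|[set t | f t == i]|] &&
     [forall j, #|[set i | (i, j) \in E]| == #|[set t | g t == j]|]) ->
  #|[set s : 'S_n | injectiveb (edge s)]| =
  #|A| * (\prod_i (#|[set t | f t == i]|)`! * \prod_j (#|[set t | g t == j]|)`!).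
Proof.
move=> AE; rewrite -sum_nat_const -sum1_card.
rewrite (partition_big (fun s : 'S_n => [set edge s t | t in 'I_n]) (mem A)) /= => [|s].
  apply: eq_bigr => E; rewrite AE => /andP[/'forall_eqP Er /'forall_eqP Ec].
  by rewrite -(card_realizes Er Ec) -[RHS]sum1_card; apply: eq_bigl => s; rewrite !inE.
rewrite inE AE => /injectiveP si; apply/andP; split; apply/'forall_eqP => i.
  rewrite -(card_in_imset (f := g \o s)) => [|t t'].
    apply: eq_card => j; rewrite [LHS]inE; apply/imsetP/imsetP => [[t _ [-> ->]]|[t]].
      by exists t; rewrite ?inE.
    by rewrite inE => /eqP <- ->; exists t.
  by rewrite !inE => /eqP e /eqP e' ge; apply: si; move: ge; rewrite /= e e' => ->.
rewrite -[RHS](card_imset _ (@perm_inj _ s^-1%g)) -(card_in_imset (f := f)) => [|t t'].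
  apply: eq_card => j; rewrite [LHS]inE; apply/imsetP/imsetP => [[t _ [-> ->]]|[t]].
    by exists t => //; apply/imsetP; exists (s t); rewrite ?inE ?permK.
  move=> /imsetP[t']; rewrite inE => /eqP <- -> ->.
    by exists (s^-1%g t') => //; rewrite permKV.
move=> /imsetP[q]; rewrite inE => /eqP e -> /imsetP[q']; rewrite inE => /eqP e' -> fe.
by apply: si; rewrite /= fe !permKV e e'.
Qed.

(** * The clashes and their number *)

Definition clashes : seq (('I_n * 'I_n) * ('I_n * 'I_n)) :=
  [seq e <- enum {: ('I_n * 'I_n) * ('I_n * 'I_n)} | clash f g e && (e.1.1 < e.2.1)].

Lemma clashes_clash : all (clash f g) clashes.
Proof. by apply/allP => e; rewrite mem_filter => /andP[/andP[]]. Qed.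

Lemma clashes_uniq : uniq clashes.
Proof. by rewrite filter_uniq // enum_uniq. Qed.

Lemma clashes_asym e : e \in clashes -> (e.2, e.1) \notin clashes.
Proof.
rewrite !mem_filter /= => /andP[/andP[_ lt] _].
by rewrite [_ < e.1.1]ltnNge (ltnW lt) andbF.
Qed.

(** A multiple edge at out-points [p < q] makes the clash [((p, s p), (q, s q))] occur; conversely,
    a clash that occurs is a multiple edge. *)
Lemma avoiding_clashes : avoiding clashes [::] = [set s : 'S_n | injectiveb (edge s)].
Proof.
apply/setP => s; rewrite !inE /=; apply/allP/injectiveP => [H t t' [ft gt]|si e].
  suff wl (p q : 'I_n) : p < q -> f p = f q -> g (s p) <> g (s q).
    case: (ltngtP t t') => [lt|lt|/val_inj//]; first by case: (wl _ _ lt ft gt).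
    by case: (wl _ _ lt (esym ft) (esym gt)).
  move=> lt fe ge; have := H ((p, s p), (q, s q)).
  rewrite /occurs /= !eqxx mem_filter mem_enum inE lt andbT /clash /=.
  rewrite fe ge !eqxx (inj_eq perm_inj).
  by rewrite neq_ltn lt => /(_ isT).
rewrite mem_filter => /andP[/andP[/and4P[e1 /eqP e2 _ /eqP e4] _] _].
apply: contraNN e1 => /andP[/eqP s1 /eqP s2]; apply/eqP/si.
by rewrite /= e2 s1 s2 e4.
Qed.

(** The sum of the [c i] counts the diagonal pairs. The set counted here supplies the factors
    [alpha_2 - alpha_1] and [beta_2 - beta_1], without natural-number subtraction. *)
Lemma card_same_fiber (K : finType) (k : 'I_n -> K) (c : K -> nat) :
  (forall i, #|[set t | k t == i]| = c i) ->
  #|[set x : 'I_n * 'I_n | (x.1 != x.2) && (k x.1 == k x.2)]| + \sum_i c i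
    = \sum_i c i ^ 2.
Proof.
move=> kc; under eq_bigr do rewrite -kc; under [RHS]eq_bigr do rewrite -kc.
pose A := [set x : 'I_n * 'I_n | k x.1 == k x.2].
have -> : \sum_i #|[set t | k t == i]| = n.
  rewrite -[RHS]card_ord -[RHS]sum1_card [RHS](partition_big k predT) //=.
  by apply: eq_bigr => i _; rewrite -sum1_card; apply: eq_bigl => t; rewrite inE.
transitivity #|A|.
  rewrite -(cardsID [set x : 'I_n * 'I_n | x.1 == x.2] A) addnC; congr (_ + _).
    rewrite -[n in LHS]card_ord.
    rewrite -(card_imset predT (f := fun t => (t, t))) => [|t t' []//].
    apply: eq_card => -[p q]; rewrite !inE /=; apply/imsetP/andP => [[t _ [-> ->]] //|].
    by case=> _ /eqP ->; exists q.
  by apply: eq_card => x; rewrite !inE.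
rewrite -sum1_card (partition_big (fun x => k x.1) predT) //=; apply: eq_bigr => i _.
rewrite -mulnn -cardsX -sum1_card; apply: eq_bigl => -[p q]; rewrite !inE /=.
by rewrite andbC; case: (k p =P i) => //= ->; rewrite eq_sym.
Qed.

(** Exchanging the two edges maps the listed clashes onto those with reversed order, hence the
    doubling. Regrouping a clash into two out-points and two in-points gives the product. *)
Lemma size_clashes :
  (size clashes).*2 = #|[set x : 'I_n * 'I_n | (x.1 != x.2) && (f x.1 == f x.2)]| *
                      #|[set x : 'I_n * 'I_n | (x.1 != x.2) && (g x.1 == g x.2)]|.
Proof.
pose C := [set e | clash f g e].
pose L := [set e : ('I_n * 'I_n) * ('I_n * 'I_n) | e.1.1 < e.2.1].
have CL : size clashes = #|C :&: L|.
  rewrite cardE /clashes /enum_mem -filter_predI; congr size.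
  by apply: eq_filter => e; rewrite /= !inE andbT.
have CL' : size clashes = #|C :\: L|.
  pose sw (e : ('I_n * 'I_n) * ('I_n * 'I_n)) := (e.2, e.1).
  have swK : involutive sw by case.
  rewrite CL -(card_imset _ (inv_inj swK)); apply: eq_card => e.
  rewrite (can_imset_pre _ swK) !inE /clash /= [e.2.1 == _]eq_sym [f e.2.1 == _]eq_sym.
  rewrite [e.2.2 == _]eq_sym [g e.2.2 == _]eq_sym andbC.
  case: (ltngtP e.1.1 e.2.1) => //= e12; first by rewrite (val_inj e12) eqxx.
rewrite -addnn {1}CL CL' cardsID -cardsX.
pose tr (e : ('I_n * 'I_n) * ('I_n * 'I_n)) := ((e.1.1, e.2.1), (e.1.2, e.2.2)).
have trK : involutive tr by move=> [[? ?] [? ?]].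
rewrite -(card_imset _ (inv_inj trK)); apply: eq_card => e.
by rewrite (can_imset_pre _ trK) !inE /clash /= -!andbA.
Qed.

End Configurations.

(** The points are the elements of the disjoint union of the ['I_(a i)], numbered by [enum_val]. *)
Lemma exists_fibers (I : finType) (a : I -> nat) n : \sum_i a i = n ->
  exists f : 'I_n -> I, forall i, #|[set t | f t == i]| = a i.
Proof.
move=> an; have cT : n = #|{: {i : I & 'I_(a i)}}|.
  rewrite card_tagged sumnE big_map big_enum /= -an.
  by apply: eq_bigr => i _; rewrite card_ord.
exists (fun t => tag (enum_val (cast_ord cT t))) => i.
have hinj : injective (fun t => enum_val (cast_ord cT t)).
  by move=> t t' /enum_val_inj /cast_ord_inj.
rewrite -(card_imset _ hinj) -[RHS]card_ord -[RHS]cardsT.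
rewrite -(card_imset _ (f := fun x : 'I_(a i) => Tagged (fun i => 'I_(a i)) x))
  => [|x y]; last first.
  by move/eqP; rewrite eq_Tagged => /eqP.
apply: eq_card => -[j x]; apply/imsetP/imsetP => [[t]|[y _ ->]].
  rewrite inE => /eqP <- ->; case: (enum_val _) => j' x' /=; by exists x'.
exists (cast_ord (esym cT) (enum_rank (Tagged (fun i => 'I_(a i)) y))).
  by rewrite inE cast_ordKV enum_rankK.
by rewrite cast_ordKV enum_rankK.
Qed.

(** * Numerical inequalities *)

Lemma leq_same_fiber (I : finType) (a : I -> nat) d n P :
  (forall i, a i <= d) -> \sum_i a i = n -> P + n = \sum_i a i ^ 2 -> P <= d * n.
Proof.
move=> ad an PE; rewrite (leq_trans (leq_addr n P)) // PE -an big_distrr /=.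
by apply: leq_sum => i _; rewrite -mulnn leq_mul2r ad orbT.
Qed.

(** Used with [e = d ^ 2], this turns a switching bound into a ratio. From [8 * e <= S] comes the
    crude [V * S <= 2 * W], which is fed back into the correction term [3 * e * V]. *)
Lemma fix_ratio_le (S e k V W : nat) : 8 * e <= S -> k <= e ->
  V * (S - (2 * e + k)) <= W -> S * (S * V) <= (S + 8 * e) * W.
Proof.
move=> eS ke VW.
have h1 : V * (S - 3 * e) <= W.
  by rewrite (leq_trans _ VW) // leq_mul2l leq_sub2l ?orbT //; lia.
have h2 : V * S <= W + 3 * e * V by move: h1; rewrite mulnBr; lia.
have h3 : V * S <= 2 * W.
  have : V * (8 * e) <= V * S by rewrite leq_mul2l eS orbT.
  lia.
have h4 : 3 * e * (V * S) <= 3 * e * (2 * W) by rewrite leq_mul2l h3 orbT.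
have h5 : S * (V * S) <= S * (W + 3 * e * V) by rewrite leq_mul2l h2 orbT.
lia.
Qed.

(** As [S - 4 * e] is at least half of [S], each crowded set [c] satisfies [c * S <= 2 * (e * W)];
    the two together stay within [8 * e * W]. *)
Lemma fix_ratio_ge (S e k V W a b : nat) : 8 * e <= S -> k <= e ->
  W <= S * V + a + b -> a * (S - (2 * e + k)) <= e * W ->
  b * (S - (3 * e + k)) <= e * W -> S * W <= S * (S * V) + 8 * e * W.
Proof.
move=> eS ke WV ha hb.
have aux c m : m <= 4 * e -> c * (S - m) <= e * W -> c * S <= 2 * (e * W).
  move=> me hc.
  have h1 : c * (S - 4 * e) <= e * W.
    by rewrite (leq_trans _ hc) // leq_mul2l leq_sub2l ?orbT.
  have : c * (8 * e) <= c * S by rewrite leq_mul2l eS orbT.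
  by move: h1; rewrite mulnBr; lia.
have {}ha := aux _ _ _ ha; have {}hb := aux _ _ _ hb.
have h1 := ha ltac:(lia); have h2 := hb ltac:(lia).
have : S * W <= S * (S * V + a + b) by rewrite leq_mul2l WV orbT.
lia.
Qed.

From mathcomp Require Import all_order all_algebra.
From mathcomp Require Import all_classical all_reals all_analysis.
From mathcomp Require Import ring lra.
Import Order.TTheory GRing.Theory Num.Theory.

(** * Probability of avoiding all clashes *)

Section Probability.
Variables (T I J : finType) (f : T -> I) (g : T -> J) (d : nat).
Hypothesis f_le : forall i, #|[set t | f t == i]%SET| <= d.
Hypothesis g_le : forall j, #|[set t | g t == j]%SET| <= d.
Hypothesis d_gt0 : 0 < d.
Hypothesis d_small : 8 * d ^ 2 <= #|T|.
Variable R : realType.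
(** [x] bounds the relative error of prescribing one image; [u] is the ideal probability of a
    clash. *)
Local Notation x := (8 * (d ^ 2)%:R / #|T|%:R : R)%R.
Local Notation u := (#|T|%:R ^- 2 : R)%R.

Local Open Scope ring_scope.

Let S_gt0 : 0 < #|T|%:R :> R.
Proof. by rewrite ltr0n (leq_trans _ d_small) // muln_gt0 expn_gt0 d_gt0. Qed.

Lemma fix_probability F D p q : all (clash f g) F -> (size D <= 1)%N ->
  p \notin unzip1 D -> q \notin unzip2 D ->
  (forall y, y \in D -> ((p, q), y) \notin F /\ (y, (p, q)) \notin F) ->
  (1 - x) * #|avoiding F D|%:R <= #|T|%:R * #|avoiding F ((p, q) :: D)|%:R
    <= (1 + x) * #|avoiding F D|%:R.
Proof.
move=> Fc D1 pD qD DF.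
have De : (size D <= d ^ 2)%N by rewrite (leq_trans D1) // expn_gt0 d_gt0.
have := fix_ratio_le d_small De (card_fix_le f_le g_le q Fc pD).
have := fix_ratio_ge d_small De (card_fix_ge Fc pD qD DF)
  (card_crowded_start f_le g_le D p (g q) Fc) (card_crowded_end f_le g_le q Fc pD).
rewrite -(natrM _ 8 (d ^ 2)); move: (8 * d ^ 2)%N => m.
set W := #|avoiding F D|; set V := #|avoiding F _|.
have := S_gt0; move: #|T| W V => S W V S0.
rewrite -!(ler_nat R) !natrD !natrM !natrD => ge le.
apply/andP; split; rewrite -(ler_pM2l S0).
  rewrite [X in X <= _](_ : _ = S%:R * W%:R - m%:R * W%:R); first by lra.
  by field; rewrite gt_eqF.
rewrite [X in _ <= X](_ : _ = (S%:R + m%:R) * W%:R); first by lra.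
by field; rewrite gt_eqF.
Qed.

(** The two edges are prescribed in turn, hence the squares. That neither ordering of [e] lies in
    [F] permits the second step, where [D] holds the first edge. *)
Lemma event_probability F e : all (clash f g) F -> clash f g e ->
  e \notin F -> (e.2, e.1) \notin F ->
  (1 - x) ^+ 2 * u * #|avoiding F [::]|%:R <= #|avoiding F [:: e.2; e.1]|%:R
    <= (1 + x) ^+ 2 * u * #|avoiding F [::]|%:R.
Proof.
case: e => [[p1 q1] [p2 q2]] Fc /and4P[/= p12 _ q12 _] eF eF'.
have /andP[a1 a2] := @fix_probability F [::] p1 q1 Fc isT isT isT (fun=> ltac:(by [])).
have /andP[b1 b2] : (1 - x) * #|avoiding F [:: (p1, q1)]|%:R
    <= #|T|%:R * #|avoiding F [:: (p2, q2); (p1, q1)]|%:R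
    <= (1 + x) * #|avoiding F [:: (p1, q1)]|%:R.
  apply: fix_probability => //; rewrite /= ?inE 1?eq_sym //.
  by move=> y; rewrite inE => /eqP ->.
have S0 := S_gt0.
have x1 : x <= 1 by rewrite ler_pdivrMr // mul1r -natrM ler_nat.
have x0 : 0 <= x by rewrite divr_ge0.
set X := x in a1 a2 b1 b2 x1 x0 *.
have S2 : 0 < #|T|%:R ^+ 2 :> R by rewrite exprn_gt0.
apply/andP; split.
  rewrite mulrAC ler_pdivrMr // mulrC expr2 [leRHS]mulrC -[leRHS]mulrA.
  rewrite mulrC -mulrA (le_trans (ler_wpM2l _ a1)) ?subr_ge0 // mulrCA.
  by rewrite ler_pM2l.
rewrite mulrAC ler_pdivlMr // [leLHS]mulrC expr2 [leRHS]mulrC.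
rewrite -mulrA mulrC -[leLHS]mulrA.
have := ler_wpM2l (ltW S0) b2; have : 0 <= 1 + X by lra.
move=> x10; have := ler_wpM2l x10 a2; lra.
Qed.

(** Take [t = p / (1 - p)] in [1 + t <= expR t]; then [1 + t] is the inverse of [1 - p]. *)
Lemma expR_le_1B (p : R) : p < 1 -> expR (- (p / (1 - p))) <= 1 - p.
Proof.
move=> p1; have p0 : 0 < 1 - p by lra.
rewrite expRN -[leRHS]invrK lef_pV2 ?posrE ?invr_gt0 ?expR_gt0 //.
rewrite (le_trans _ (expR_ge1Dx _)) //.
by rewrite le_eqVlt; apply/orP; left; apply/eqP; field; rewrite gt_eqF.
Qed.

(** Each further clash multiplies the count by 1 minus its conditional probability, enclosed between
    two exponentials in [step]; the exponents add up along [F]. *)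
Lemma avoiding_bounds F : all (clash f g) F -> uniq F ->
    (forall e, e \in F -> (e.2, e.1) \notin F) -> 7 * x <= 1 ->
  expR (- ((size F)%:R * u * (1 + 7 * x))) * ((#|T|)`!)%:R <= #|avoiding F [::]|%:R
    <= expR (- ((size F)%:R * u * (1 - 7 * x))) * ((#|T|)`!)%:R.
Proof.
move=> Fc Fu Fs x7.
elim: F Fc Fu Fs => [_ _ _|e F IH] /=.
  rewrite !mul0r oppr0 expR0 !mul1r.
  by rewrite card_avoiding_nil lexx.
move=> /andP[ec Fc] /andP[eF Fu] Fs.
have eF' : (e.2, e.1) \notin F.
  by have := Fs e (mem_head _ _); rewrite inE negb_or => /andP[].
have Fs' e' : e' \in F -> (e'.2, e'.1) \notin F.
  move=> e'F; have := Fs e'; rewrite !inE e'F orbT negb_or.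
  by move=> /(_ isT) /andP[].
have {}IH := IH Fc Fu Fs'.
have := event_probability Fc ec eF eF'.
have := congr1 (fun n => n%:R : R) (card_avoiding_cons F e); rewrite /= natrD.
move: IH; set W := #|avoiding F _|%:R; set V := #|avoiding _ [:: _; _]|%:R.
set Z := #|avoiding _ _|%:R => IH WE.
have S0 := S_gt0.
have x0 : 0 <= x by rewrite divr_ge0.
have u0 : 0 < u by rewrite invr_gt0 exprn_gt0.
(* This lets [x] absorb the second-order error made in replacing [1 - p] by an exponential. *)
have ux : 8 * u <= x.
  rewrite expr2 invfM mulrA ler_pM2r ?invr_gt0 //.
  rewrite ler_pM ?invr_ge0 //.
  rewrite (@le_trans _ _ 1) //.
    by rewrite invf_le1 // ler1n -(ltr0n R).
  by rewrite ler1n expn_gt0 d_gt0.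
set X := x in IH x0 x7 ux *; set U := u in IH u0 ux * => /andP[Vl Vu].
have W0 : 0 <= W by rewrite ler0n.
have step : expR (- (U * (1 + 7 * X))) * W <= Z <= expR (- (U * (1 - 7 * X))) * W.
  have -> : Z = W - V by rewrite WE addrK.
  apply/andP; split.
    apply: (@le_trans _ _ ((1 - (1 + X) ^+ 2 * U) * W)); last by lra.
    apply: ler_wpM2r => //.
    (* Of the allowance [7 * X], [3 * X] pays for the square and the rest for passing from [p] to
       [p / (1 - p)]. *)
    have X1 : (1 + X) ^+ 2 <= 1 + 3 * X by nra.
    have pU : (1 + X) ^+ 2 * U <= (1 + 3 * X) * U by rewrite ler_wpM2r // ltW.
    have p12 : (1 + X) ^+ 2 * U <= 1 / 2 by nra.
    apply: le_trans (expR_le_1B _); last by lra.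
    rewrite ler_expR lerN2 ler_pdivrMr; last by lra.
    set p := (1 + X) ^+ 2 * U in pU p12 *.
    have p2 : p <= 2 * U by nra.
    have : 1 + 3 * X <= (1 + 7 * X) * (1 - p) by nra.
    by move=> /(ler_wpM2l (ltW u0)); lra.
  apply: (@le_trans _ _ ((1 - (1 - X) ^+ 2 * U) * W)); first by lra.
  apply: ler_wpM2r => //.
  apply: le_trans (expR_ge1Dx _) _; rewrite ler_expR; nra.
move/andP: step => [s1 s2]; move/andP: IH => [i1 i2].
have split_exp (c : R) :
    - ((size F).+1%:R * U * c) = - (U * c) + - ((size F)%:R * U * c).
  by rewrite -addn1 natrD; lra.
rewrite !split_exp !expRD -!(mulrA (expR _)); apply/andP; split.
  by apply: le_trans s1; rewrite ler_wpM2l // expR_ge0.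
by apply: (le_trans s2); rewrite ler_wpM2l // expR_ge0.
Qed.

End Probability.

Local Open Scope ring_scope.

(** The quotient lies between [expR (- y)] and [expR y], and [expR y <= 1 / (1 - y) <= 1 + 2 * y]
    for [y <= 1 / 2]. *)
Lemma expR_dist_le (R : realType) (w y P : R) : 0 <= y <= 1 / 2 ->
  expR (- (w + y)) <= P <= expR (- (w - y)) -> `|P / expR (- w) - 1| <= 2 * y.
Proof.
move=> /andP[y0 y1] /andP[Pl Pu]; rewrite expRN invrK.
have e0 := expR_gt0 w.
have l : expR (- y) <= P * expR w.
  by rewrite -ler_pdivrMr // -expRN -expRD (le_trans _ Pl) // ler_expR; lra.
have u : P * expR w <= expR y.
  by rewrite -ler_pdivlMr // -expRN -expRD (le_trans Pu) // ler_expR; lra.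
have h1 := expR_ge1Dx (- y).
have h2 : expR y <= 1 + 2 * y.
  rewrite -[y]opprK expRN invf_ple ?posrE ?expR_gt0 //; last by lra.
  apply: le_trans h1; rewrite opprK -div1r ler_pdivrMr; last by lra.
  nra.
by rewrite ler_distl; apply/andP; split; lra.
Qed.

(** * Asymptotics *)

Section Estimate.
Variables (R : realType) (N : nat) (a b : 'I_N -> nat) (S : nat).
Hypothesis sum_a : (\sum_i a i)%N = S.
Hypothesis sum_b : (\sum_i b i)%N = S.
Local Notation d := (max_degree a b).
Hypothesis S_gt0 : (0 < S)%N.
Hypothesis d_small : (56 * d ^ 4 <= S)%N.

Let le_d i : (a i <= d)%N /\ (b i <= d)%N.
Proof.
have := @leq_bigmax _ (fun i => maxn (a i) (b i)) i.
by rewrite geq_max => /andP.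
Qed.

Let d_gt0 : (0 < d)%N.
Proof.
rewrite lt0n; apply: contraTneq S_gt0 => d0; rewrite -sum_a big1 // => i _.
by have [] := le_d i; rewrite d0; case: (a i).
Qed.

Definition main_term : R := (S)`!%:R / \prod_(i < N) ((a i)`!%:R * (b i)`!%:R) *
  expR (- (((power_sum 2 a)%:R - (power_sum 1 a)%:R) *
           ((power_sum 2 b)%:R - (power_sum 1 b)%:R)) / (2 * S%:R ^+ 2)).

(** The exponent [w] is at most [d ^ 2 / 2] and is known up to a relative error [7 * x] with
    [x = 8 * d ^ 2 / S]; the factor 2 of [expR_dist_le] then gives 56. *)
Lemma relative_error :
  `| #|digraphs_with_bidegree a b|%:R / main_term - 1| <= 56 * (d ^ 4)%:R / S%:R.
Proof.
(* Out-points carry the out-degrees [b], in-points the in-degrees [a]. *)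
have [f fE] := exists_fibers sum_b; have [g gE] := exists_fibers sum_a.
pose m := (\prod_i (a i)`! * \prod_i (b i)`!)%N.
have m_gt0 : (0 < m)%N.
  by rewrite muln_gt0 !prodn_gt0 // => i; rewrite fact_gt0.
have simpleE : #|avoiding (clashes f g) [::]| = (#|digraphs_with_bidegree a b| * m)%N.
  rewrite avoiding_clashes (card_simple (A := digraphs_with_bidegree a b)) => [|E].
    congr (_ * _)%N; rewrite mulnC; congr (_ * _)%N; apply: eq_bigr => i _.
      by rewrite gE.
    by rewrite fE.
  rewrite inE; apply/forallP/andP => [H|[/forallP H1 /forallP H2] i].
    split; apply/forallP => i; have /andP[/eqP ia /eqP ib] := H i.
      by rewrite fE -ib.
    by rewrite gE -ia.
  by have := H1 i; have := H2 i; rewrite fE gE => /eqP <- /eqP <-; rewrite !eqxx.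
have f_le i : (#|[set t | f t == i]%SET| <= d)%N by rewrite fE; case: (le_d i).
have g_le i : (#|[set t | g t == i]%SET| <= d)%N by rewrite gE; case: (le_d i).
have d24 : (d ^ 2 <= d ^ 4)%N by rewrite leq_pexp2l.
have d8 : (8 * d ^ 2 <= #|'I_S|)%N by rewrite card_ord; lia.
have S0 : 0 < S%:R :> R by rewrite ltr0n.
have x7 : 7 * (8 * (d ^ 2)%:R / #|'I_S|%:R) <= 1 :> R.
  rewrite card_ord !mulrA ler_pdivrMr // mul1r -!natrM ler_nat; lia.
have := @avoiding_bounds _ _ _ f g d f_le g_le d_gt0 d8 R (clashes f g)
  (clashes_clash f g) (clashes_uniq f g) (@clashes_asym _ _ _ f g) x7.
have := size_clashes f g; have := card_same_fiber fE; have := card_same_fiber gE.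
set Pg := #|_|; set Pf := #|_|.
rewrite simpleE card_ord.
move=> PgE PfE nE /andP[Bl Bu].
have Pga := leq_same_fiber (fun i => (le_d i).1) erefl PgE.
have Pfb := leq_same_fiber (fun i => (le_d i).2) erefl PfE.
rewrite sum_a in PgE Pga; rewrite sum_b in PfE Pfb.
move: (size _) nE Bl Bu => n nE.
pose w : R := n%:R / S%:R ^+ 2; pose x : R := 8 * (d ^ 2)%:R / S%:R.
rewrite -/w -/x => Bl Bu.
have F0 : 0 < (S)`!%:R :> R by rewrite ltr0n fact_gt0.
have m0 : 0 < m%:R :> R by rewrite ltr0n.
have power1 (c : 'I_N -> nat) : power_sum 1 c = (\sum_i c i)%N.
  by apply: eq_bigr => i _; rewrite expn1.
have mainE : main_term = (S)`!%:R / m%:R * expR (- w).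
  rewrite /main_term; congr (_ / _ * expR _).
    by rewrite big_split natrM !natr_prod.
  rewrite !power1 sum_a sum_b /power_sum -PgE -PfE !natrD !addrK mulNr; congr (- _).
  rewrite -natrM mulnC -nE -muln2 natrM /w.
  by field; rewrite gt_eqF.
have w0 : 0 <= w by rewrite divr_ge0 // exprn_ge0.
have x0 : 0 <= x by rewrite divr_ge0.
(* The number of clashes is half a product of two factors, each at most [d * S]. *)
have w1 : w <= (d ^ 2)%:R / 2.
  rewrite ler_pdivrMr ?exprn_gt0 // mulrAC ler_pdivlMr // -natrX -!natrM ler_nat.
  rewrite muln2 nE -mulnn mulnACA mulnn mulnC leq_mul //; lia.
pose y := w * (7 * x).
have y1 : 2 * y <= 56 * (d ^ 4)%:R / S%:R.
  have -> : 56 * (d ^ 4)%:R / S%:R = 2 * ((d ^ 2)%:R / 2 * (7 * x)) :> R.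
    by rewrite /x -[4%N]/(2 * 2)%N expnM -mulnn natrM; field; rewrite gt_eqF.
  by rewrite ler_wpM2l // ler_wpM2r // mulr_ge0.
have y2 : 56 * (d ^ 4)%:R / S%:R <= 1 :> R.
  by rewrite ler_pdivrMr // mul1r -natrM ler_nat.
have -> : #|digraphs_with_bidegree a b|%:R / main_term =
    (#|digraphs_with_bidegree a b| * m)%:R / (S)`!%:R / expR (- w).
  by rewrite mainE natrM; field; rewrite !gt_eqF ?expR_gt0.
apply: le_trans (y1); apply: expR_dist_le.
  have y0 : 0 <= y by rewrite mulr_ge0 // mulr_ge0.
  by rewrite y0 /=; lra.
rewrite ler_pdivlMr // ler_pdivrMr //; apply/andP; split.
  by apply: le_trans Bl; rewrite ler_pM2r // ler_expR /y; lra.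
by apply: (le_trans Bu); rewrite ler_pM2r // ler_expR /y; lra.
Qed.

End Estimate.

(** * Powers of [S] along the sequence *)

Import numFieldNormedType.Exports.
Local Open Scope classical_set_scope.

(** The fourth power of the degree bound has exponent [1 - 4 * eps] in [s]; division by [s] leaves
    the exponent of the error. *)
Lemma fourth_power_ratio (R : realType) (k s eps D : R) : 0 < s -> 0 <= D ->
  D <= k * s `^ (4^-1 - eps) -> D ^+ 4 / s <= k ^+ 4 * s `^ (- (4 * eps)).
Proof.
move=> s0 D0 Dk; rewrite ler_pdivrMr // -mulrA.
have -> : s `^ (- (4 * eps)) * s = (s `^ (4^-1 - eps)) ^+ 4.
  rewrite -powR_mulrn ?powR_ge0 // -powRrM -{2}[s]powRr1 ?ltW // -powRD; last first.
    by apply/implyP => _; rewrite gt_eqF.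
  by congr (_ `^ _); field.
by rewrite -exprMn lerXn2r // nnegrE (le_trans D0).
Qed.

(** It suffices that [S m] passes the threshold c^(-1/r). *)
Lemma powR_eventually_le (R : realType) (S : nat -> nat) (r c : R) : 0 < r -> 0 < c ->
  S m @[m --> \oo] --> \oo -> \forall m \near \oo, (S m)%:R `^ (- r) <= c.
Proof.
move=> r0 c0 /cvgnyPge /(_ (Num.bound (c^-1 `^ r^-1))); apply: filterS => m Sm.
have cS : c^-1 `^ r^-1 <= (S m)%:R.
  apply: (@le_trans _ _ (Num.bound (c^-1 `^ r^-1))%:R); last by rewrite ler_nat.
  by rewrite ltW // archi_boundP // powR_ge0.
have ci : 0 < c^-1 by rewrite invr_gt0.
have S0 : 0 < (S m)%:R :> R by rewrite (lt_le_trans _ cS) // powR_gt0.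
rewrite powRN invf_ple ?posrE ?powR_gt0 //.
have -> : c^-1 = (c^-1 `^ r^-1) `^ r.
  by rewrite -powRrM mulVf ?gt_eqF // powRr1 // ltW.
by apply: ge0_ler_powR; rewrite ?nnegrE ?powR_ge0 // ltW.
Qed.

Theorem theorem7 (R : realType) (eps : R) (eps_gt0 : 0 < eps)
    (N : nat -> nat) (a b : forall m : nat, 'I_(N m) -> nat) (S : nat -> nat)
    (sum_a : forall m : nat, (\sum_(i < N m) a m i)%N = S m)
    (sum_b : forall m : nat, (\sum_(i < N m) b m i)%N = S m)
    (S_infty : S m @[m --> \oo] --> \oo)
    (max_bound : (fun m : nat => (max_degree (a m) (b m))%:R : R) =O_\oo
                 (fun m : nat => (S m)%:R `^ (4^-1 - eps) : R)) :
  exists2 err : nat -> R,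
    err =O_\oo (fun m : nat => (S m)%:R `^ (- (4 * eps)) : R) &
    forall m : nat,
      #|digraphs_with_bidegree (a m) (b m)|%:R =
        (1 + err m) *
        ((S m)`!%:R / \prod_(i < N m) ((a m i)`!%:R * (b m i)`!%:R) *
         expR (- (((power_sum 2 (a m))%:R - (power_sum 1 (a m))%:R) *
                  ((power_sum 2 (b m))%:R - (power_sum 1 (b m))%:R))
               / (2 * (S m)%:R ^+ 2))).
Proof.
pose main m : R := main_term R (a m) (b m) (S m).
have main_gt0 m : 0 < main m.
  rewrite /main /main_term mulr_gt0 ?expR_gt0 // divr_gt0 ?ltr0n ?fact_gt0 //.
  by apply: prodr_gt0 => i _; rewrite mulr_gt0 // ltr0n fact_gt0.
(* The error is read off from the exact quotient, so the identity holds for every [m] and only an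
   eventual bound remains. *)
exists (fun m => #|digraphs_with_bidegree (a m) (b m)|%:R / main m - 1); last first.
  move=> m; rewrite addrC subrK -/(main_term R (a m) (b m) (S m)).
  by rewrite divfK // gt_eqF // main_gt0.
have /eqO_exP[k k0 Ok] := max_bound.
(* 56 comes from [relative_error], [k ^+ 4] from the fourth power of the degree bound. *)
apply/eqO_exP; exists (56 * k ^+ 4); first by rewrite mulr_gt0 // exprn_gt0.
have e4 : 0 < 4 * eps by rewrite mulr_gt0.
have c0 : 0 < (56 * k ^+ 4)^-1 by rewrite invr_gt0 mulr_gt0 // exprn_gt0.
(* This smallness secures the hypothesis [56 * d ^ 4 <= S] of [relative_error] for large [m]. *)
have small := @powR_eventually_le _ _ _ _ e4 c0 S_infty.
have /cvgnyPge /(_ 1%N) S1 := S_infty.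
near=> m.
have Sm : (0 < S m)%N by near: m.
have Dm : (max_degree (a m) (b m))%:R <= k * (S m)%:R `^ (4^-1 - eps).
  have : `|(max_degree (a m) (b m))%:R : R| <= k * `|(S m)%:R `^ (4^-1 - eps)| by near: m.
  by rewrite normr_nat ger0_norm ?powR_ge0.
have Sm0 : 0 < (S m)%:R :> R by rewrite ltr0n.
have Q := @fourth_power_ratio _ _ _ _ _ Sm0 (ler0n _ _) Dm.
have sm : (S m)%:R `^ (- (4 * eps)) <= (56 * k ^+ 4)^-1 by near: m.
have Q1 : 56 * ((max_degree (a m) (b m))%:R ^+ 4 / (S m)%:R)
    <= 56 * (k ^+ 4 * (S m)%:R `^ (- (4 * eps))).
  by rewrite ler_pM2l.
rewrite [X in _ <= _ * X]ger0_norm ?powR_ge0 //.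
rewrite -[leRHS]mulrA; apply: le_trans (Q1); rewrite -natrX mulrA.
apply: relative_error => //.
rewrite -(ler_nat R) natrM natrX -[leRHS]mul1r -ler_pdivrMr // -mulrA.
apply: (le_trans Q1).
by rewrite mulrA -ler_pdivlMl ?mulr_gt0 ?exprn_gt0 // mulr1.
Unshelve. all: by end_near. Qed.
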